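(* Let $K$ be a field, let $A$ be an ASL on a poset $P$ over $K$ and let $M$ be a graded MSL on a poset $Q$ over $A$, with the elements of $Q$ homogeneous. Let $d=\max\{\deg(p):p\in P\}$ and $m=\max\{\deg(q):q\in Q\}$. Then $$\operatorname{rate}_A(M)\le d+m.$$
   Context: All posets are finite. A poset ideal of a poset $P$ is a subset $I$ such that $\alpha\in I$, $\beta\in P$, $\beta\le\alpha$ imply $\beta\in I$. **ASL.** Let $A$ be a $K$-algebra and $P\subset A$ a finite poset. A product $\alpha_1\cdots\alpha_t$ with $\alpha_i\in P$ is a monomial; it is standard if $\alpha_1\le\cdots\le\alpha_t$. $A$ is a (graded) algebra with straightening laws (ASL) on $P$ over $K$ if: (ASL 0) $A=\bigoplus_{i\ge0}A_i$ is a graded $K$-algebra with $A_0=K$, the elements of $P$ are homogeneous of positive degree and generate $A$ as a $K$-algebra; (ASL 1) the standard monomials form a $K$-basis of $A$; (ASL 2) if $\alpha,\beta\in P$ are incomparable and $\alpha\beta=\sum_i r_i\gamma_{i1}\cdots\gamma_{it_i}$, with $0\ne r_i\in K$ and $\gamma_{i1}\le\cdots\le\gamma_{it_i}$, is the unique expression as a linear combination of standard monomials (possibly $0$), then $\gamma_{i1}<\alpha$ and $\gamma_{i1}<\beta$ for every $i$. **MSL.** Let $A$ be an ASL on $P$ over $K$. An $A$-module $M$ is a module with straightening laws (MSL) on a finite poset $Q\subset M$ if: (MSL 1) for every $x\in Q$ there is a poset ideal $\mathcal I(x)\subset P$ such that the elements $\alpha_1\cdots\alpha_i x$ with $x\in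 Q$, $i\ge0$, $\alpha_1\le\cdots\le\alpha_i$ in $P$ and $\alpha_1\notin\mathcal I(x)$ form a $K$-basis of $M$; (MSL 2) for every $x\in Q$ and $\alpha\in\mathcal I(x)$ one has $\alpha x\in\sum_{y<x}Ay$. **Rate.** For a finitely generated graded $A$-module $M$, put $t_i(M)=\sup\{j:\operatorname{Tor}_i^A(M,K)_j\ne0\}$ and $\operatorname{rate}_A(M)=\sup_{i\ge1}\{t_i(M)/i\}$.
   Formalization: Here m is read as max(0, max deg q), the modules being Z-graded; with all degrees of Q negative the printed bound fails, e.g. A = K[x,y], M = K placed in degree -5, where d+m = -4 but the rate is at least -3/2. *)

(* Defs.v *)
From HB Require Import structures.
From mathcomp Require Import all_boot all_order all_algebra.
From mathcomp Require Import boolp classical_sets reals constructive_ereal ereal.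

Set Implicit Arguments.
Unset Strict Implicit.
Unset Printing Implicit Defensive.

Import Order.TTheory GRing.Theory Num.Theory.
Local Open Scope classical_set_scope.
Local Open Scope ring_scope.

(* V is the internal direct sum of the subgroups G i.  For graded algebras and
   modules as below the G i are automatically K-subspaces, since A_0 = K. *)
Definition is_grading (I : eqType) (V : zmodType) (G : I -> set V) : Prop :=
  [/\ forall i, G i 0,
      forall i x y, G i x -> G i y -> G i (x - y),
      forall x, exists (s : seq I) (c : I -> V),
        [/\ uniq s, forall i, G i (c i) & x = \sum_(i <- s) c i]
    & forall (s : seq I) (c : I -> V), uniq s -> (forall i, G i (c i)) ->
        \sum_(i <- s) c i = 0 -> forall i, i \in s -> c i = 0].

Definition is_graded_algebra (K : fieldType) (A : comAlgType K)
    (AG : nat -> set A) : Prop :=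
  [/\ is_grading AG,
      AG 0%N = range (fun k : K => k%:A)
    & forall i j x y, AG i x -> AG j y -> AG (i + j)%N (x * y)].

Definition is_graded_module (K : fieldType) (A : comAlgType K)
    (AG : nat -> set A) (M : lmodType A) (MG : int -> set M) : Prop :=
  is_grading MG /\
  forall i j a x, AG i a -> MG j x -> MG (i%:Z + j) (a *: x).

(* The family (v i), i ranging over the indices satisfying D, is a K-basis of
   the A-module M, on which k : K acts as k%:A : A. *)
Definition is_Kbasis (K : fieldType) (A : comAlgType K) (M : lmodType A)
    (I : eqType) (D : pred I) (v : I -> M) : Prop :=
  (forall x, exists (s : seq I) (c : I -> K),
     [/\ uniq s, all D s & x = \sum_(i <- s) (c i)%:A *: v i]) /\
  (forall (s : seq I) (c : I -> K), uniq s -> all D s ->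
     \sum_(i <- s) (c i)%:A *: v i = 0 -> forall i, i \in s -> c i = 0).

Definition is_subalgebra (K : fieldType) (A : comAlgType K) (S : set A) : Prop :=
  [/\ S 1, forall (k : K) x y, S x -> S y -> S (k *: x + y)
    & forall x y, S x -> S y -> S (x * y)].

Definition standard (dP : Order.disp_t) (P : finPOrderType dP) (s : seq P) : bool :=
  sorted <=%O s.

Definition monomial (K : fieldType) (A : comAlgType K) (P : Type) (e : P -> A)
    (s : seq P) : A :=
  \prod_(a <- s) e a.

(* The poset P sits inside A through e; degP p is the degree of e p. *)
Record is_ASL (K : fieldType) (A : comAlgType K) (AG : nat -> set A)
    (dP : Order.disp_t) (P : finPOrderType dP) (e : P -> A) (degP : P -> nat)
    : Prop := IsASL {
  ASL_inj : injective e;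
  ASL0_graded : is_graded_algebra AG;
  ASL0_homog : forall p, AG (degP p) (e p);
  ASL0_pos : forall p, (0 < degP p)%N;
  ASL0_gen : forall S : set A, is_subalgebra S -> (forall p, S (e p)) ->
    S = setT;
  ASL1 : is_Kbasis (M := A^o) (@standard dP P) (monomial e);
  ASL2 : forall a b : P, (a >< b)%O ->
    forall (s : seq (seq P)) (r : seq P -> K),
      uniq s -> all (@standard dP P) s -> (forall g, g \in s -> r g != 0) ->
      e a * e b = \sum_(g <- s) r g *: monomial e g ->
      forall g, g \in s ->
        if g is g1 :: _ then (g1 < a)%O && (g1 < b)%O else false
}.

Definition poset_ideal (dP : Order.disp_t) (P : finPOrderType dP) (I : {set P})
    : Prop :=
  forall a b : P, a \in I -> (b <= a)%O -> b \in I.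

Definition MSL_standard (dP : Order.disp_t) (P : finPOrderType dP) (Q : Type)
    (I : Q -> {set P}) (t : seq P * Q) : bool :=
  standard t.1 && (if t.1 is a1 :: _ then a1 \notin I t.2 else true).

Definition is_MSL (K : fieldType) (A : comAlgType K)
    (dP : Order.disp_t) (P : finPOrderType dP) (e : P -> A)
    (M : lmodType A) (dQ : Order.disp_t) (Q : finPOrderType dQ) (q : Q -> M)
    : Prop :=
  injective q /\
  exists I : Q -> {set P},
    [/\ forall x, poset_ideal (I x),
        is_Kbasis (MSL_standard I)
          (fun t : seq P * Q => monomial e t.1 *: q t.2)
      & forall (x : Q) (a : P), a \in I x ->
          exists c : Q -> A, e a *: q x = \sum_(y : Q | (y < x)%O) c y *: q y].

(* The grading of A extended by A_n = 0 for n < 0. *)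
Definition zpart (K : fieldType) (A : comAlgType K) (AG : nat -> set A)
    (n : int) : set A :=
  match n with Posz k => AG k | Negz _ => [set 0] end.

(* A_+, the sum of the A_n with n > 0; K is the A-module A / A_+. *)
Definition irrelevant (K : fieldType) (A : comAlgType K) (AG : nat -> set A)
    : set A :=
  [set a | exists (s : seq nat) (c : nat -> A),
     (forall n, AG n (c n)) /\ a = \sum_(n <- s | (0 < n)%N) c n].

(* A graded free resolution ... -> F_1 -> F_0 -> M -> 0 with F_i of finite
   rank.  F_i is the module of row vectors 'rV[A]_(rk i), whose k-th basis
   vector has degree gdeg i k; the map F_(i+1) -> F_i is v |-> v *m diff i,
   and all maps are homogeneous of degree 0. *)
Record gr_free_resolution (K : fieldType) (A : comAlgType K)
    (AG : nat -> set A) (M : lmodType A) (MG : int -> set M) := GrFreeResolution {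
  rk : nat -> nat;
  gdeg : forall i, 'I_(rk i) -> int;
  diff : forall i, 'M[A]_(rk i.+1, rk i);
  augm : 'I_(rk 0) -> M;
  diff_homog : forall i k l,
    zpart AG (@gdeg i.+1 k - @gdeg i l) (diff i k l);
  augm_homog : forall k, MG (@gdeg 0%N k) (augm k);
  augm_surj : forall x : M, exists v : 'rV[A]_(rk 0),
    x = \sum_k v 0 k *: augm k;
  augm_exact : forall v : 'rV[A]_(rk 0),
    \sum_k v 0 k *: augm k = 0 <-> exists w, v = w *m diff 0%N;
  diff_exact : forall i (v : 'rV[A]_(rk i.+1)),
    v *m diff i = 0 <-> exists w, v = w *m diff i.+1
}.

Section Tor.
Variables (K : fieldType) (A : comAlgType K) (AG : nat -> set A).
Variables (M : lmodType A) (MG : int -> set M).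

Section Resolution.
Variable F : gr_free_resolution AG MG.

Definition homog_vec (i : nat) (j : int) (v : 'rV[A]_(rk F i)) : Prop :=
  forall k, zpart AG (j - gdeg k) (v 0 k).

(* F_i tensor K is F_i / A_+ F_i; this is the kernel of F_i -> F_i tensor K. *)
Definition vanish_tensK (n : nat) (v : 'rV[A]_n) : Prop :=
  forall k, irrelevant AG (v 0 k).

Definition cycle_tensK (i : nat) : 'rV[A]_(rk F i) -> Prop :=
  match i with
  | 0 => fun=> True
  | i'.+1 => fun v => vanish_tensK (v *m diff F i')
  end.

Definition boundary_tensK (i : nat) (v : 'rV[A]_(rk F i)) : Prop :=
  exists w : 'rV[A]_(rk F i.+1), vanish_tensK (v - w *m diff F i).

Definition homology_tensK_neq0 (i : nat) (j : int) : Prop :=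
  exists v : 'rV[A]_(rk F i),
    [/\ homog_vec j v, cycle_tensK v & ~ boundary_tensK v].

End Resolution.

(* Tor_i^A(M, K)_j <> 0, where Tor_i^A(M, K) = H_i(F tensor K).  The homology
   does not depend on F, and some F exists whenever M is a finitely generated
   graded module, A being Noetherian. *)
Definition Tor_neq0 (i : nat) (j : int) : Prop :=
  exists F : gr_free_resolution AG MG, homology_tensK_neq0 F i j.

Variable R : realType.

Definition t_ (i : nat) : \bar R :=
  ereal_sup [set (j%:~R)%:E | j in [set j : int | Tor_neq0 i j]].

Definition rate : \bar R :=
  ereal_sup [set (t_ i * (i%:R^-1)%:E)%E | i in [set i : nat | (0 < i)%N]].

End Tor.

Definition max_degP (P : finType) (degP : P -> nat) : nat :=
  \max_(p : P) degP p.

(* Maximum of the degrees of the elements of Q, read as 0 if all of them are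
   negative (or Q is empty).  The bound d + m does not hold with a negative m:
   for A = K[x, y] with its standard grading and M = K placed in degree -5 one
   has m = -5, d = 1, but t_2(M) = -3, so the rate is at least -3/2. *)
Definition max_degQ (Q : finType) (degQ : Q -> int) : int :=
  \big[Order.max/0]_(x : Q) degQ x.

(* Main.v *)
Require Import Defs.
From HB Require Import structures.
From mathcomp Require Import all_boot all_order all_algebra.
From mathcomp Require Import boolp classical_sets reals constructive_ereal ereal.

Set Implicit Arguments.
Unset Strict Implicit.
Unset Printing Implicit Defensive.

Import Order.TTheory GRing.Theory Num.Theory.
Local Open Scope classical_set_scope.
Local Open Scope ring_scope.

(** A free resolution G of M can be written down whose i-th module has a basis
    of degree at most i * d + m.  By the comparison theorem Tor_i(M, K) is then
    zero above degree i * d + m, and dividing by i >= 1, where m >= 0, gives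
    the bound d + m on the rate.

    The resolution comes from the fact that the first syzygies of an MSL again
    form an MSL.  For x in Q and alpha in I(x) the second MSL axiom gives a
    relation rho(x, alpha) = alpha eps_x - (terms eps_y with y < x) in the free
    module on Q; its degree is deg alpha + deg x <= d + m.  Dividing by these
    relations rewrites every element into a combination of the standard
    elements of M ([reduction]), and these are linearly independent in M; so
    the relations rho(x, alpha) generate the kernel ([relation_in_span]).  They
    satisfy the MSL axioms for the ideals
    I(x, alpha) = { beta | not alpha <= beta } and the lexicographic order of
    the pairs (x, alpha): a product of rho(x, alpha) with a standard monomial
    starting at or above alpha has as leading term a standard monomial times
    eps_x, and different products have different leading terms ([syz_free]);
    if beta is not above alpha, then straightening beta alpha yields only terms
    that start below alpha ([syz_straight]).  Iterating, each step raises the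
    degrees by at most d.

    Because Tor is read off an arbitrary resolution F, the comparison
    theorem ([homology_degree_le]) is proved for it directly: a homogeneous chain map
    phi : F -> G, a chain map psi : G -> F, and a homotopy from their composite
    F -> G -> F to the identity.  A homogeneous element of F_i of degree above
    the degrees of the basis of G_i is mapped by phi into A_+ G_i, so if it is a
    cycle modulo A_+ it is a boundary modulo A_+. *)

(** * Spans and linear independence *)

Lemma big_uniq_extend (T : eqType) (V : nmodType) (s t : seq T) (f : T -> V) :
  uniq s -> uniq t -> {subset s <= t} ->
  \sum_(i <- t) (if i \in s then f i else 0) = \sum_(i <- s) f i.
Proof.
move=> us ut st; rewrite -big_mkcond -big_filter; apply: perm_big.
apply: uniq_perm; rewrite ?filter_uniq // => i; rewrite mem_filter.
by case: (boolP (i \in s)) => // /st ->.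
Qed.

Section Spans.
Variables (K : fieldType) (A : comAlgType K) (N : lmodType A).

Section AModuleSpan.
Variables (k : nat) (g : 'I_k -> N).
Implicit Types (D : pred 'I_k) (v w : 'rV[A]_k).

Definition comb v : N := \sum_l v 0 l *: g l.

Lemma combB v w : comb (v - w) = comb v - comb w.
Proof. by rewrite -sumrB; apply: eq_bigr => l _; rewrite !mxE scalerBl. Qed.

Lemma combD v w : comb (v + w) = comb v + comb w.
Proof. by rewrite -big_split; apply: eq_bigr => l _; rewrite !mxE scalerDl. Qed.

Lemma combZ a v : comb (a *: v) = a *: comb v.
Proof. by rewrite scaler_sumr; apply: eq_bigr => l _; rewrite !mxE scalerA. Qed.

Lemma comb_sum (T : Type) (s : seq T) (Q : pred T) (f : T -> 'rV[A]_k) :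
  comb (\sum_(t <- s | Q t) f t) = \sum_(t <- s | Q t) comb (f t).
Proof.
apply: (big_morph comb combD).
by rewrite /comb big1 // => i _; rewrite mxE scale0r.
Qed.

Lemma comb_delta x : comb (delta_mx 0 x) = g x.
Proof.
rewrite /comb (bigD1 x) //= big1 ?addr0 => [|l /negbTE lx].
  by rewrite mxE !eqxx scale1r.
by rewrite mxE lx andbF scale0r.
Qed.

Definition in_span D (x : N) : Prop :=
  exists2 c : 'rV[A]_k, forall i, ~~ D i -> c 0 i = 0 & x = comb c.

Lemma in_spanD D x y : in_span D x -> in_span D y -> in_span D (x + y).
Proof.
case=> [c hc ->] [d hd ->]; exists (c + d); last by rewrite combD.
by move=> i hi; rewrite mxE hc ?hd ?addr0.
Qed.

Lemma in_spanZ D a x : in_span D x -> in_span D (a *: x).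
Proof.
case=> [c hc ->]; exists (a *: c); last by rewrite combZ.
by move=> i hi; rewrite mxE hc ?mulr0.
Qed.

Lemma in_span_gen D i : D i -> in_span D (g i).
Proof.
move=> Di; exists (delta_mx 0 i); last by rewrite comb_delta.
by move=> j hj; rewrite mxE; case: (j =P i) hj => [->|]; rewrite ?Di ?andbF.
Qed.

Lemma in_span0 D : in_span D 0.
Proof.
exists 0; first by move=> i _; rewrite mxE.
by rewrite /comb big1 // => i _; rewrite mxE scale0r.
Qed.

Lemma in_span_sum D (T : eqType) (s : seq T) (f : T -> N) :
  (forall t, t \in s -> in_span D (f t)) -> in_span D (\sum_(t <- s) f t).
Proof.
move=> hf; rewrite big_seq; elim/big_rec: _ => [|t x ts]; first exact: in_span0.
by apply: in_spanD; apply: hf.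
Qed.

Lemma in_span_sub D D' x : {subset D <= D'} -> in_span D x -> in_span D' x.
Proof.
by move=> sD [c hc ex]; exists c => // i hi; apply/hc/(contra _ hi)/sD.
Qed.

End AModuleSpan.

Section KSpan.
Variables (I : eqType) (D : pred I) (v : I -> N).

Definition in_Kspan (x : N) : Prop := exists s (c : I -> K),
  [/\ uniq s, all D s & x = \sum_(i <- s) (c i)%:A *: v i].

Definition Kfree : Prop := forall s (c : I -> K), uniq s -> all D s ->
  \sum_(i <- s) (c i)%:A *: v i = 0 -> forall i, i \in s -> c i = 0.

Lemma in_KspanD x y : in_Kspan x -> in_Kspan y -> in_Kspan (x + y).
Proof.
case=> s [c [us Ds ->]] [t [d [ut Dt ->]]].
pose u := undup (s ++ t); have uu : uniq u by rewrite undup_uniq.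
exists u, (fun i => (if i \in s then c i else 0) +
                   (if i \in t then d i else 0)).
split=> //.
  by apply/allP => i; rewrite mem_undup mem_cat => /orP[/(allP Ds)|/(allP Dt)].
have su : {subset s <= u} by move=> j js; rewrite mem_undup mem_cat js.
have tu : {subset t <= u} by move=> j jt; rewrite mem_undup mem_cat jt orbT.
rewrite -(big_uniq_extend _ us uu su) -(big_uniq_extend _ ut uu tu) -big_split.
apply: eq_bigr => i _ /=; rewrite !scalerDl; congr (_ + _);
  by case: ifP => // _; rewrite !scale0r.
Qed.

Lemma in_Kspan0 : in_Kspan 0.
Proof. by exists [::], (fun=> 0); split; rewrite ?big_nil. Qed.

Lemma in_Kspan_gen c i : D i -> in_Kspan (c%:A *: v i).
Proof.
by move=> Di; exists [:: i], (fun=> c); rewrite big_seq1 /= Di; split.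
Qed.

(** Transfers independence to a differently indexed family; the change of index
    from standard elements to their leading monomials is injective only on the
    elements with the same leading generator. *)
Lemma Kfree_map (J : eqType) (f : J -> I) (s : seq J) (c : J -> K) :
  Kfree -> {in s &, injective f} -> uniq s -> all (fun j => D (f j)) s ->
  \sum_(j <- s) (c j)%:A *: v (f j) = 0 -> forall j, j \in s -> c j = 0.
Proof.
move=> hfree finj us Ds sum0 j js.
(* On the image of s the coefficient of i is that of its preimage in s. *)
pose c' i := c (nth j s (find (fun j' => f j' == i) s)).
have c'E j' : j' \in s -> c' (f j') = c j'.
  move=> js'; rewrite /c'; congr c.
  have hasf : has (fun j'' => f j'' == f j') s by apply/hasP; exists j'.
  apply: finj => //; first by rewrite mem_nth -?has_find.
  exact/eqP/(nth_find j hasf).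
rewrite -c'E //; apply: (hfree (map f s)); last exact: map_f.
- by rewrite map_inj_in_uniq.
- by rewrite all_map.
- rewrite big_map -[RHS]sum0 big_seq [RHS]big_seq.
  by apply: eq_bigr => i si; rewrite c'E.
Qed.

End KSpan.
End Spans.

(** * Gradings and homogeneous components *)

Section GradingProjections.
Variables (I : eqType) (V : zmodType) (G : I -> set V).
Hypothesis hG : is_grading G.

Lemma gradingD i x y : G i x -> G i y -> G i (x + y).
Proof.
case: hG => G0 GB _ _ Gx Gy; rewrite -[y]opprK; apply: (GB) => //.
by rewrite -[- y]add0r; apply: (GB).
Qed.

Lemma grading_unique s t c c' : uniq s -> uniq t ->
  (forall i, G i (c i)) -> (forall i, G i (c' i)) ->
  \sum_(i <- s) c i = \sum_(i <- t) c' i ->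
  forall i, (if i \in s then c i else 0) = (if i \in t then c' i else 0).
Proof.
case: (hG) => G0 GB _ Gind us ut hc hc' eq_sum i.
pose u := undup (s ++ t).
have uu : uniq u by rewrite undup_uniq.
have su : {subset s <= u} by move=> j js; rewrite mem_undup mem_cat js.
have tu : {subset t <= u} by move=> j jt; rewrite mem_undup mem_cat jt orbT.
pose f j := (if j \in s then c j else 0) - (if j \in t then c' j else 0).
have Gf j : G j (f j).
  by apply: GB; case: ifP.
have sum0 : \sum_(j <- u) f j = 0.
  by rewrite big_split /= sumrN !big_uniq_extend // eq_sum subrr.
have [iu|niu] := boolP (i \in u).
  by apply/eqP; rewrite -subr_eq0; apply/eqP/(Gind u f uu Gf sum0).
move: niu; rewrite mem_undup mem_cat negb_or.
by case/andP => /negbTE -> /negbTE ->.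
Qed.

(** Uniqueness of the decomposition makes the components additive functions
    of the element. *)
Lemma grading_projections : exists pi : I -> V -> V,
  [/\ forall i x y, pi i (x + y) = pi i x + pi i y,
      forall i x, G i (pi i x),
      forall i j x, G i x -> pi j x = if i == j then x else 0
    & forall x, exists2 s, uniq s & x = \sum_(i <- s) pi i x].
Proof.
case: (hG) => G0 GB Gdec Gind.
have /choice [S /choice [C hSC]] := Gdec.
pose pi i x := if i \in S x then C x i else 0.
have piE x s c : uniq s -> (forall i, G i (c i)) -> x = \sum_(i <- s) c i ->
    forall i, pi i x = if i \in s then c i else 0.
  move=> us hc ex i; have [uS hC eC] := hSC x.
  by apply: grading_unique => //; rewrite -ex.
have Gpi i x : G i (pi i x).
  by rewrite /pi; case: ifP => // _; case: (hSC x).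
have decx x : x = \sum_(i <- S x) pi i x.
  have [uS hC {1}->] := hSC x; rewrite -[LHS](big_uniq_extend (t := S x)) //.
exists pi; split => //.
- move=> i x y; pose u := undup (S x ++ S y).
  have uu : uniq u by rewrite undup_uniq.
  have [ux _ _] := hSC x; have [uy _ _] := hSC y.
  rewrite (piE (x + y) u (fun i => pi i x + pi i y)) //.
  + case: ifPn => //; rewrite mem_undup mem_cat negb_or /pi.
    by case/andP => /negbTE -> /negbTE ->; rewrite addr0.
  + by move=> j; apply: gradingD.
  + rewrite big_split /= {1}/pi {1}/pi !big_uniq_extend //.
    * by case: (hSC x) => _ _ <-; case: (hSC y) => _ _ <-.
    * by move=> j js; rewrite mem_undup mem_cat js orbT.
    * by move=> j js; rewrite mem_undup mem_cat js.
- move=> i j x Gx.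
  rewrite (piE x [:: i] (fun k => if k == i then x else 0)) //.
  + by rewrite inE eq_sym; case: (i == j).
  + by move=> k; case: eqP => [->|].
  + by rewrite big_seq1 eqxx.
- by move=> x; exists (S x) => //; case: (hSC x).
Qed.

End GradingProjections.

Section Components.
Variables (K : fieldType) (A : comAlgType K) (AG : nat -> set A).

(** A graded module in terms of its projections pi j onto the homogeneous
    parts.  Unlike the existence of a decomposition, this form passes to free
    modules coordinate by coordinate. *)
Record has_components (N : lmodType A) (NG : int -> set N)
    (pi : int -> N -> N) : Prop := HasComponents {
  compD : forall j x y, pi j (x + y) = pi j x + pi j y;
  comp_homog : forall j x, NG j (pi j x);
  comp_id : forall i j x, NG i x -> pi j x = if i == j then x else 0;
  comp_scale : forall i j a x, AG i a -> NG j x -> NG (i%:Z + j) (a *: x)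
}.

Section ComponentsTheory.
Variables (N : lmodType A) (NG : int -> set N) (pi : int -> N -> N).
Hypothesis hpi : has_components NG pi.

Lemma comp0 j : pi j 0 = 0.
Proof. by apply: (@addrI _ (pi j 0)); rewrite -(compD hpi) !addr0. Qed.

Lemma comp_sum j (T : Type) (s : seq T) (Q : pred T) (f : T -> N) :
  pi j (\sum_(i <- s | Q i) f i) = \sum_(i <- s | Q i) pi j (f i).
Proof.
exact: (big_morph (pi j) (compD hpi j) (comp0 j)).
Qed.

End ComponentsTheory.

(** For A itself the decomposition is kept: by additivity it reduces statements
    about all scalars to homogeneous ones. *)
Definition algebra_components (piA : int -> A -> A) : Prop :=
  has_components (N := A^o) (zpart AG) piA /\
  forall a, exists2 s, uniq s & a = \sum_(n <- s) piA (Posz n) a.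

Lemma algebra_components_exist : is_graded_algebra AG ->
  exists piA, algebra_components piA.
Proof.
case=> hG _ hM; have [pi [piD piG piI piS]] := grading_projections hG.
pose piA z a := if z is Posz n then pi n a else 0.
exists piA; split; last by move=> a; have [s us e] := piS a; exists s.
split.
- by case=> [n|n] x y /=; rewrite ?piD ?addr0.
- by case=> [n|n] x /=; first exact: piG.
- case=> [n|n] j x /=.
    by move=> Gx; case: j => [m|m] //=; rewrite (piI n).
  by move=> ->; rewrite if_same; case: j => [m|m] //=;
     rewrite (piI m _ 0) ?if_same //; case: hG.
- move=> i j a x Ga.
  case: j => [n|n] /=; first exact: hM.
  move=> ->; rewrite scaler0.
  by case: (i%:Z + Negz n) => [k|k] //=; case: hG.
Qed.

Lemma module_components_exist (M : lmodType A) (MG : int -> set M) :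
  is_graded_module AG MG -> exists pi, has_components MG pi.
Proof.
case=> hG hM; have [pi [piD piG piI _]] := grading_projections hG.
by exists pi; split.
Qed.

Variable piA : int -> A -> A.
Hypothesis hA : algebra_components piA.

(** Both sides are additive in a, which may hence be taken homogeneous. *)
Lemma comp_scale_homog (N : lmodType A) (NG : int -> set N) pi i j a x :
  has_components NG pi -> NG i x -> pi j (a *: x) = piA (j - i) a *: x.
Proof.
move=> hpi Gx; have [hA1 hA2] := hA; have [s _ ->] := hA2 a.
rewrite scaler_suml (comp_sum hpi) (comp_sum hA1) scaler_suml.
apply: eq_bigr => n _; set b := piA n a.
have Gb : zpart AG n b by exact: (comp_homog hA1 (Posz n)).
rewrite (comp_id hpi _ (comp_scale hpi Gb Gx)) (comp_id hA1 _ Gb).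
rewrite [_ == j - i]eq_sym subr_eq eq_sym.
by case: eqP => // _; rewrite scale0r.
Qed.


Lemma homogP (N : lmodType A) (NG : int -> set N) pi :
  has_components NG pi -> forall j x, NG j x <-> pi j x = x.
Proof.
move=> hpi j x; split=> [Gx|<-]; last exact: (comp_homog hpi).
by rewrite (comp_id hpi j Gx) eqxx.
Qed.

Lemma homogB (N : lmodType A) (NG : int -> set N) pi j x y :
  has_components NG pi -> NG j x -> NG j y -> NG j (x - y).
Proof.
move=> hpi /(homogP hpi) ex /(homogP hpi) ey; apply/(homogP hpi).
by apply: (addIr y); rewrite -{2}ey -(compD hpi) !subrK.
Qed.

(** The grading of the free module with basis vectors of degrees deg, and its
    homogeneous components. *)
Definition row_homog (k : nat) (deg : 'I_k -> int) (j : int) : set 'rV[A]_k :=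
  [set v | forall l, zpart AG (j - deg l) (v 0 l)].

Definition row_comp (k : nat) (deg : 'I_k -> int) (j : int) (v : 'rV[A]_k) :=
  \row_l piA (j - deg l) (v 0 l).

Lemma row_has_components k (deg : 'I_k -> int) :
  has_components (row_homog deg) (row_comp deg).
Proof.
have [h _] := hA; split.
- by move=> j x y; apply/rowP=> l; rewrite !mxE (compD h).
- by move=> j x l; rewrite mxE; apply: (comp_homog h).
- move=> i j x Gx; apply/rowP=> l; rewrite mxE (comp_id h _ (Gx l)).
  by rewrite (inj_eq (addIr _)); case: eqP => // _; rewrite mxE.
- move=> i j a x Ga Gx l; rewrite mxE -addrA.
  exact: (comp_scale h Ga (Gx l)).
Qed.

(** An expression of a homogeneous element in homogeneous generators may be
    replaced by its component of the right degree. *)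
Lemma comb_row_comp (N : lmodType A) (NG : int -> set N) pi k
    (g : 'I_k -> N) (deg : 'I_k -> int) j v :
  has_components NG pi -> (forall l, NG (deg l) (g l)) ->
  comb g (row_comp deg j v) = pi j (comb g v).
Proof.
move=> hpi hg; rewrite /comb (comp_sum hpi); apply: eq_bigr => l _.
by rewrite mxE (comp_scale_homog _ _ hpi (hg l)).
Qed.

Lemma homog_mul i j a b :
  zpart AG i a -> zpart AG j b -> zpart AG (i + j) (a * b).
Proof.
have [h _] := hA; case: i => [n|n] Ha Hb; first exact: (comp_scale h Ha Hb).
by rewrite (Ha : a = 0) mul0r; apply/(homogP h); rewrite (comp0 h).
Qed.

Lemma homog_sum (N : lmodType A) (NG : int -> set N) pi j (T : Type)
    (s : seq T) (f : T -> N) :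
  has_components NG pi -> (forall i, NG j (f i)) -> NG j (\sum_(i <- s) f i).
Proof.
move=> hpi hf; apply/(homogP hpi); rewrite (comp_sum hpi).
by apply: eq_bigr => i _; apply/(homogP hpi).
Qed.

Lemma irrelevantP a : irrelevant AG a <-> piA 0 a = 0.
Proof.
have [h hdec] := hA; split=> [[s [c [hc ->]]]|a0].
  rewrite (comp_sum h) big1 // => n n0.
  by rewrite (comp_id h _ (hc n : zpart AG n (c n))); case: n n0.
have [s us ea] := hdec a; exists s, (fun n => piA (Posz n) a); split.
  by move=> n; apply: (comp_homog h (Posz n)).
rewrite big_mkcond {1}ea; apply: eq_bigr => n _.
by case: n => [|n] /=; first rewrite a0.
Qed.

Lemma irrelevantD a b :
  irrelevant AG a -> irrelevant AG b -> irrelevant AG (a + b).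
Proof.
by have [h _] := hA; move=> /irrelevantP ea /irrelevantP eb;
  apply/irrelevantP; rewrite (compD h) ea eb addr0.
Qed.

Lemma irrelevant_homog n a : 0 < n -> zpart AG n a -> irrelevant AG a.
Proof.
have [h _] := hA; move=> n0 Ga; apply/irrelevantP.
by rewrite (comp_id h 0 Ga) gt_eqF.
Qed.

Lemma irrelevant_sum (T : Type) (s : seq T) (f : T -> A) :
  (forall i, irrelevant AG (f i)) -> irrelevant AG (\sum_(i <- s) f i).
Proof.
have [h _] := hA; move=> hf; apply/irrelevantP; rewrite (comp_sum h).
by apply: big1 => i _; apply/irrelevantP.
Qed.

Lemma irrelevantM a b : irrelevant AG a -> irrelevant AG (a * b).
Proof.
have [h hdec] := hA; case=> s [c [hc ->]]; have [t _ ->] := hdec b.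
rewrite big_mkcond mulr_suml; apply: irrelevant_sum => n.
case: ifP => n0; last by rewrite mul0r; apply/irrelevantP; rewrite (comp0 h).
rewrite mulr_sumr; apply: irrelevant_sum => m.
apply: (@irrelevant_homog (n + m)%N).
  by rewrite ltz_nat ltn_addr.
rewrite PoszD; apply: homog_mul; first exact: (hc n).
exact: (comp_homog h).
Qed.

Lemma vanish_tensKD n (v w : 'rV[A]_n) :
  vanish_tensK AG v -> vanish_tensK AG w -> vanish_tensK AG (v + w).
Proof. by move=> hv hw l; rewrite mxE; apply: irrelevantD. Qed.

Lemma vanish_tensK_mul n n' (v : 'rV[A]_n) (X : 'M[A]_(n, n')) :
  vanish_tensK AG v -> vanish_tensK AG (v *m X).
Proof.
by move=> hv l; rewrite mxE; apply: irrelevant_sum => i; apply: irrelevantM.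
Qed.

(** * Comparison of graded free resolutions *)

Section Comparison.
Variables (M : lmodType A) (MG : int -> set M).
Hypothesis hMG : is_graded_module AG MG.
Implicit Types F G : gr_free_resolution AG MG.

(* The degrees of the basis of F_i, and the images of the basis of F_0. *)
Local Notation bdeg F i := (@gdeg _ _ _ _ _ F i).
Local Notation aug F := (@augm _ _ _ _ _ F).

Definition res_ker F i : 'rV[A]_(rk F i) -> Prop :=
  match i return 'rV[A]_(rk F i) -> Prop with
  | 0 => fun v => comb (aug F) v = 0
  | i'.+1 => fun v => v *m diff F i' = 0
  end.

Lemma res_exact F i (v : 'rV[A]_(rk F i)) :
  res_ker v <-> exists w, v = w *m diff F i.
Proof. by case: i v => [|i] v; [apply: augm_exact|apply: diff_exact]. Qed.

Lemma matrix_lift F i n (X : 'M[A]_(n, rk F i)) :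
  (forall k, res_ker (row k X)) -> exists Y, X = Y *m diff F i.
Proof.
move=> hX.
have /choice [w hw] : forall k, exists w, row k X = w *m diff F i.
  by move=> k; apply/res_exact.
exists (\matrix_k w k); apply/row_matrixP => k.
by rewrite row_mul rowK.
Qed.

Lemma diff_row_homog F i k :
  row_homog (bdeg F i) (bdeg F i.+1 k) (row k (diff F i)).
Proof. by move=> l; rewrite mxE; apply: diff_homog. Qed.

Lemma combE_mul k n (v : 'rV[A]_k) (X : 'M[A]_(k, n)) :
  v *m X = comb (fun i => row i X) v.
Proof. by rewrite mulmx_sum_row. Qed.

Definition homog_matrix F G i (X : 'M[A]_(rk F i, rk G i)) : Prop :=
  forall k, row_homog (bdeg G i) (bdeg F i k) (row k X).


Lemma diff_diff F i : diff F i.+1 *m diff F i = 0.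
Proof.
apply/row_matrixP => k; rewrite row0 row_mul.
by apply/(diff_exact (i := i)); exists (delta_mx 0 k); rewrite -rowE.
Qed.

Lemma row_homog_mul k n (deg : 'I_k -> int) (deg' : 'I_n -> int) j
    (v : 'rV[A]_k) (X : 'M[A]_(k, n)) :
  row_homog deg j v -> (forall i, row_homog deg' (deg i) (row i X)) ->
  row_homog deg' j (v *m X).
Proof.
have [h _] := hA; move=> hv hX l; rewrite mxE.
apply: (@homog_sum A^o _ _ _ _ _ _ h) => i.
rewrite -(subrKA (deg i)); apply: homog_mul; first exact: hv.
by have := hX i l; rewrite mxE.
Qed.

(** Lift the rows by exactness and keep the components of the right degree. *)
Lemma matrix_lift_homog F i n (deg : 'I_n -> int) (X : 'M[A]_(n, rk F i)) :
  (forall k, res_ker (row k X)) ->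
  (forall k, row_homog (bdeg F i) (deg k) (row k X)) ->
  exists2 Y, forall k, row_homog (bdeg F i.+1) (deg k) (row k Y)
           & X = Y *m diff F i.
Proof.
move=> /matrix_lift [Y eX] hX.
exists (\matrix_k row_comp (bdeg F i.+1) (deg k) (row k Y)).
  by move=> k; rewrite rowK; apply: (comp_homog (row_has_components _)).
apply/row_matrixP => k; rewrite row_mul rowK combE_mul.
rewrite (comb_row_comp _ _ (row_has_components _) (@diff_row_homog F i)).
rewrite -combE_mul -row_mul -eX.
by apply/esym/(homogP (row_has_components _)).
Qed.

(** Lifting the identity of M along the resolution G. *)
Lemma chain_map F G : exists phi : forall i, 'M[A]_(rk F i, rk G i),
  [/\ forall i, homog_matrix (phi i),
      forall v, comb (aug G) (v *m phi 0%N) = comb (aug F) v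
    & forall i, phi i.+1 *m diff G i = diff F i *m phi i].
Proof.
have [pi hpi] := module_components_exist hMG.
pose ok i (X : 'M[A]_(rk F i, rk G i)) :=
  homog_matrix X /\ forall v, res_ker v -> res_ker (v *m X).
have [X0 hX0 eX0] : exists2 X : 'M[A]_(rk F 0, rk G 0), homog_matrix X &
    forall v, comb (aug G) (v *m X) = comb (aug F) v.
  have /choice [w hw] := fun k => augm_surj G (aug F k).
  pose X := \matrix_k row_comp (bdeg G 0) (bdeg F 0 k) (w k).
  exists X.
    by move=> k; rewrite rowK; apply: (comp_homog (row_has_components _)).
  move=> v; rewrite mulmx_sum_row comb_sum; apply: eq_bigr => k _.
  rewrite combZ rowK (comb_row_comp _ _ hpi (@augm_homog _ _ _ _ _ G)).
  rewrite (_ : comb _ (w k) = aug F k); last by rewrite hw.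
  by rewrite (proj1 (homogP hpi _ _) (@augm_homog _ _ _ _ _ F k)).
have ok0 : ok 0%N X0 by split=> // v /= hv; rewrite eX0.
have step i (X : {X | @ok i X}) : exists Y : {Y | @ok i.+1 Y},
    sval Y *m diff G i = diff F i *m sval X.
  case: X => X [hX kX] /=.
  have [Y hY eY] : exists2 Y, homog_matrix Y & diff F i *m X = Y *m diff G i.
    apply: matrix_lift_homog => k; rewrite row_mul.
      apply/kX/res_exact; exists (delta_mx 0 k).
      by rewrite -rowE.
    exact: (row_homog_mul (diff_row_homog k) hX).
  have okY : ok i.+1 Y.
    by split=> // v /= hv; rewrite -mulmxA -eY mulmxA hv mul0mx.
  by exists (exist _ Y okY).
(* The invariant ok is what the choice of the next matrix requires, so the
   recursion runs over matrices bundled with it. *)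
pose T i := {X | @ok i X}.
have ex_next : forall p : {i & T i}, exists Y : T (tag p).+1,
  sval Y *m diff G (tag p) = diff F (tag p) *m sval (tagged p) by case.
pose seqX i : T i :=
  nat_rect T (exist _ X0 ok0) (fun i X => sval (cid (ex_next (Tagged T X)))) i.
exists (fun i => sval (seqX i)); split.
- by move=> i; case: (svalP (seqX i)).
- exact: eX0.
- by move=> i; exact: (svalP (cid (ex_next (Tagged T (seqX i))))).
Qed.

(** The comparison theorem: if the generators of G_i have degree at most b,
    then Tor_i vanishes above degree b, whichever resolution F computes it.
    The composite F -> G -> F of the two lifts of the identity of M maps an
    element of F_i of degree above b into A_+ F_i, because it factors through
    A_+ G_i, and it is homotopic to the identity. *)
Lemma homology_degree_le F G i j (b : int) :
  (forall k, bdeg G i.+1 k <= b) -> homology_tensK_neq0 F i.+1 j -> j <= b.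
Proof.
have [phi [homphi augphi commphi]] := chain_map F G.
have [psi [_ augpsi commpsi]] := chain_map G F.
pose theta k := 1%:M - phi k *m psi k.
have comm_theta k : theta k.+1 *m diff F k = diff F k *m theta k.
  rewrite mulmxBl mulmxBr mul1mx mulmx1 -mulmxA commpsi !mulmxA.
  by rewrite commphi.
(* The homotopy is chosen recursively: the equation kept with h makes the rows
   of theta k.+1 - diff k * h cycles. *)
pose T k := {h : 'M[A]_(rk F k, rk F k.+1) |
  diff F k *m (theta k - h *m diff F k) = 0}.
have [h0 eh0] : exists h, theta 0%N = h *m diff F 0.
  apply: matrix_lift => k /=; rewrite rowE mulmxBr mulmx1.
  by rewrite combB mulmxA augpsi augphi subrr.
have ok0 : diff F 0 *m (theta 0%N - h0 *m diff F 0) = 0.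
  by rewrite eh0 subrr mulmx0.
have ex_next : forall p : {k & T k}, exists Y : T (tag p).+1,
    theta (tag p).+1 = sval Y *m diff F (tag p).+1 +
                        diff F (tag p) *m sval (tagged p).
  case=> k [h hh] /=.
  have [Y eY] : exists Y, theta k.+1 - diff F k *m h = Y *m diff F k.+1.
    apply: matrix_lift => l /=; rewrite -row_mul mulmxBl comm_theta -mulmxA.
    by rewrite -mulmxBr hh row0.
  have okY : diff F k.+1 *m (theta k.+1 - Y *m diff F k.+1) = 0.
    by rewrite -eY subKr mulmxA diff_diff mul0mx.
  by exists (exist _ Y okY); rewrite /= -eY subrK.
pose h k : T k :=
  nat_rect T (exist _ h0 ok0) (fun k X => sval (cid (ex_next (Tagged T X)))) k.
have hh k : theta k.+1 = sval (h k.+1) *m diff F k.+1 + diff F k *m sval (h k).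
  exact: (svalP (cid (ex_next (Tagged T (h k))))).
move=> hdeg [v [hv cv nbv]]; rewrite leNgt; apply/negP => ltbj; apply: nbv.
exists (v *m sval (h i.+1)).
have -> : v - v *m sval (h i.+1) *m diff F i.+1 =
    v *m phi i.+1 *m psi i.+1 + v *m diff F i *m sval (h i).
  have := congr1 (mulmx v) (hh i).
  rewrite mulmxBr mulmx1 mulmxDr !mulmxA => /eqP.
  by rewrite subr_eq => /eqP ev; rewrite {1}ev addrC -addrA addKr addrC.
apply: vanish_tensKD; last exact: vanish_tensK_mul.
apply: vanish_tensK_mul => l.
apply: (@irrelevant_homog (j - bdeg G i.+1 l)).
  by rewrite subr_gt0; apply: le_lt_trans ltbj.
exact: (row_homog_mul hv (homphi i.+1)).
Qed.
End Comparison.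
End Components.

(** * Syzygies of straightening families *)

Section Straightening.
Variables (K : fieldType) (A : comAlgType K) (AG : nat -> set A).
Variables (dP : Order.disp_t) (P : finPOrderType dP) (e : P -> A).
Variable degP : P -> nat.
Hypothesis hASL : is_ASL AG e degP.

Lemma ASL_Kfree : Kfree (N := A^o) (@standard dP P) (monomial e).
Proof. by case: (ASL1 hASL). Qed.

(** When b < a the product b a is itself standard and starts with b; when a and
    b are incomparable this is the second ASL axiom. *)
Lemma straighten_product (a b : P) : ~~ (a <= b)%O ->
  exists s (r : seq P -> K),
    (forall t, t \in s ->
      standard t && (if t is c :: _ then (c < a)%O else false)) /\
    e b * e a = \sum_(t <- s) (r t)%:A * monomial e t.
Proof.
move=> nab; have [ltba|nltba] := boolP (b < a)%O.
  exists [:: [:: b; a]], (fun=> 1); split.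
    by move=> t; rewrite inE => /eqP ->; rewrite /standard /= ltba ltW.
  by rewrite big_seq1 scale1r mul1r /monomial !big_cons big_nil mulr1.
have incab : (b >< a)%O.
  by move: nab nltba; case: (comparableP a b).
have [s [c [us sts ec]]] := (ASL1 hASL).1 (e b * e a : A^o).
have ec' : e b * e a = \sum_(t <- [seq t <- s | c t != 0]) c t *: monomial e t.
  rewrite ec big_filter [RHS]big_mkcond; apply: eq_bigr => t _ /=.
  rewrite -[LHS]/((c t)%:A * monomial e t) -scalerAl mul1r.
  by case: eqP => //= ->; rewrite scale0r.
exists [seq t <- s | c t != 0], c; split.
  have std' : all (@standard dP P) [seq t <- s | c t != 0].
    by apply/allP => u; rewrite mem_filter => /andP[_ /(allP sts)].
  have nz u : u \in [seq t <- s | c t != 0] -> c u != 0.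
    by rewrite mem_filter => /andP[].
  move=> t ts; have := ASL2 hASL incab (filter_uniq _ us) std' nz ec' ts.
  by rewrite (allP std') //; case: t ts => // d t _ /andP[].
by rewrite ec'; apply: eq_bigr => t _; rewrite -scalerAl mul1r.
Qed.

Definition std_elt (N : lmodType A) k (g : 'I_k -> N) (t : seq P * 'I_k) : N :=
  monomial e t.1 *: g t.2.

(** The submodule generated by the family g is an MSL on it.  A rank function
    stands for the partial order of the generators, so that syzygies can be
    indexed by ordinals again. *)
Record straightening_family (N : lmodType A) k (g : 'I_k -> N)
    (I : 'I_k -> {set P}) (r : 'I_k -> nat) : Prop := StraighteningFamily {
  sf_ideal : forall x, poset_ideal (I x);
  sf_free : Kfree (MSL_standard I) (std_elt g);
  sf_straight : forall x a, a \in I x ->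
    in_span g (fun y => r y < r x)%N (e a *: g x)
}.

Section Syzygies.
Variables (N : lmodType A) (k : nat) (g : 'I_k -> N).
Variables (I : 'I_k -> {set P}) (r : 'I_k -> nat).
Hypothesis hsf : straightening_family g I r.
Variable corr : 'I_k -> P -> 'rV[A]_k.
Hypothesis corr_supp : forall x a y, a \in I x -> ~~ (r y < r x)%N ->
  corr x a 0 y = 0.
Hypothesis corrE : forall x a, a \in I x -> e a *: g x = comb g (corr x a).

Definition syz (x : 'I_k) (a : P) : 'rV[A]_k := e a *: delta_mx 0 x - corr x a.

Definition syz_type : predArgType := {p : 'I_k * P | p.2 \in I p.1}.

Local Notation k' := #|{: syz_type}|.

Definition syz_gen (i : 'I_k') : 'I_k := (sval (enum_val i)).1.
Definition syz_var (i : 'I_k') : P := (sval (enum_val i)).2.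
Definition syz_fam (i : 'I_k') : 'rV[A]_k := syz (syz_gen i) (syz_var i).
Definition syz_ideal (i : 'I_k') : {set P} :=
  [set b | ~~ (syz_var i <= b)%O]%SET.

(** The lexicographic rank: the second summand is at most #|P|. *)
Definition syz_rank (i : 'I_k') : nat :=
  (r (syz_gen i) * #|P|.+1 + #|[pred b | (b < syz_var i)%O]|)%N.

Lemma syz_varP i : syz_var i \in I (syz_gen i).
Proof. exact: (svalP (enum_val i)). Qed.

Lemma syz_index x a : a \in I x -> exists2 i, syz_gen i = x & syz_var i = a.
Proof.
move=> aI; exists (enum_rank (exist _ (x, a) aI : syz_type));
  by rewrite /syz_gen /syz_var enum_rankK.
Qed.

Lemma syz_index_inj i j :
  syz_gen i = syz_gen j -> syz_var i = syz_var j -> i = j.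
Proof.
move=> eg ev; apply: enum_val_inj; apply: val_inj.
by rewrite [LHS]surjective_pairing [RHS]surjective_pairing; congr pair.
Qed.

Lemma comb_syz x a : a \in I x -> comb g (syz x a) = 0.
Proof.
by move=> aI; rewrite combB combZ comb_delta corrE // subrr.
Qed.

Lemma comb_comb_syz w : comb g (comb syz_fam w) = 0.
Proof.
rewrite comb_sum big1 // => i _.
by rewrite combZ comb_syz ?scaler0 // syz_varP.
Qed.

Definition normal_form := in_Kspan (MSL_standard I)
  (std_elt (fun x : 'I_k => delta_mx 0 x : 'rV[A]_k)).

(** The division algorithm: a standard monomial alpha_1 ... alpha_s eps_x with
    alpha_1 in I x is rewritten by the syzygy of (x, alpha_1), and the
    correction terms only involve generators of smaller rank. *)
Lemma reduction n (v : 'rV[A]_k) : (forall y, ~~ (r y < n)%N -> v 0 y = 0) ->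
  exists2 u, normal_form u &
    in_span syz_fam (fun i => r (syz_gen i) < n)%N (v - u).
Proof.
elim: n v => [|n IH] v hv.
  exists 0; first exact: in_Kspan0.
  have -> : v - 0 = 0 by apply/rowP => y; rewrite subr0 mxE hv.
  exact: in_span0.
(* The claim is additive in v, so it is enough to treat c * s * eps_x with c in
   K and s a standard monomial. *)
pose good w := exists2 u, normal_form u &
    in_span syz_fam (fun i => r (syz_gen i) < n.+1)%N (w - u).
have goodD w w' : good w -> good w' -> good (w + w').
  move=> [u nu su] [u' nu' su']; exists (u + u'); first exact: in_KspanD.
  by rewrite opprD addrACA; apply: in_spanD.
have good0 : good 0.
  by exists 0; [exact: in_Kspan0|rewrite subrr; exact: in_span0].
have good_term (c : K) (s : seq P) (x : 'I_k) : (r x < n.+1)%N -> standard s ->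
    good (c%:A *: (monomial e s *: delta_mx 0 x)).
  move=> rx sts; have [std|] := boolP (MSL_standard I (s, x)).
    exists (c%:A *: (monomial e s *: delta_mx 0 x)).
      exact: (in_Kspan_gen (std_elt _) c std).
    by rewrite subrr; apply: in_span0.
  rewrite /MSL_standard sts /=; case: s sts => //= a s _; rewrite negbK => aI.
  have [i gi vi] := syz_index aI.
  have -> : c%:A *: (monomial e (a :: s) *: delta_mx 0 x) =
      (c%:A * monomial e s) *: syz_fam i +
      (c%:A * monomial e s) *: corr x a :> 'rV[A]_k.
    rewrite -scalerDr /syz_fam /syz gi vi subrK /monomial big_cons !scalerA.
    by congr (_ *: _); rewrite [e a * _]mulrC mulrA.
  apply: goodD.
    exists 0; first exact: in_Kspan0.
    by rewrite subr0; apply/in_spanZ/in_span_gen; rewrite gi.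
  have [|u nu su] := IH ((c%:A * monomial e s) *: corr x a).
    move=> y hy; rewrite mxE corr_supp ?mulr0 //.
    by apply: contra hy => /leq_trans -> //.
  by exists u => //; apply: in_span_sub su => i' /= /ltnW.
rewrite (row_sum_delta v); elim/big_ind: _ => // x _.
have [rx|nrx] := boolP (r x < n.+1)%N; last by rewrite hv // scale0r.
have [s [c [us sts ->]]] := (ASL1 hASL).1 (v 0 x : A^o).
rewrite scaler_suml big_seq; elim/big_ind: _ => // t ts.
rewrite -[X in X *: _]/((c t)%:A * monomial e t) -scalerA.
by apply: good_term => //; apply: (allP sts).
Qed.

(** The syzygies span the relations: the normal form of a relation is a
    relation between standard elements, hence trivial. *)
Lemma relation_in_span n (v : 'rV[A]_k) :
  (forall y, ~~ (r y < n)%N -> v 0 y = 0) -> comb g v = 0 ->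
  in_span syz_fam (fun i => r (syz_gen i) < n)%N v.
Proof.
move=> hv gv; have [u [s [c [us ds eu]]] [w sw ew]] := reduction hv.
have gu : comb g u = 0.
  rewrite -[u](subKr v) combB gv ew sub0r.
  apply/eqP; rewrite oppr_eq0; apply/eqP.
  exact: comb_comb_syz.
have c0 t : t \in s -> c t = 0.
  apply: (sf_free hsf us ds); rewrite -[RHS]gu eu comb_sum.
  by apply: eq_bigr => i _; rewrite !combZ comb_delta.
have u0 : u = 0 by rewrite eu big_seq big1 // => t ts; rewrite c0 // !scale0r.
by exists w => //; rewrite -ew u0 subr0.
Qed.

Lemma syz_exact (v : 'rV[A]_k) :
  comb g v = 0 <-> exists w, v = comb syz_fam w.
Proof.
split=> [gv|[w ->]].
  pose n := (\max_y r y).+1.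
  have [|w _ ->] := @relation_in_span n v _ gv; last by exists w.
  by move=> y; rewrite ltnS leq_bigmax.
exact: comb_comb_syz.
Qed.

(** In a relation between standard elements of the syzygies consider a
    generator x of largest rank that occurs.  The eps_x coordinate of the
    relation only sees the leading terms alpha_1 ... alpha_s alpha eps_x with
    alpha <= alpha_1, and these are distinct standard monomials. *)
Lemma syz_free : Kfree (MSL_standard syz_ideal) (std_elt syz_fam).
Proof.
move=> s c us ds sum0.
pose R (t : seq P * 'I_k') := r (syz_gen t.2).
pose B := (\max_y r y).+1.
suff main m t : t \in s -> (B <= R t + m)%N -> c t = 0.
  by move=> t ts; apply: (main B) => //; rewrite leq_addl.
elim: m t => [|m IH] t ts; first by rewrite addn0 ltnNge leq_bigmax.
move=> hB; have c_top t' : t' \in s -> (R t < R t')%N -> c t' = 0.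
  move=> ts' lt; apply: IH => //; apply: leq_trans hB _.
  by rewrite addnS -addSn leq_add2r.
pose x := syz_gen t.2.
pose s' := [seq t' <- s | syz_gen t'.2 == x].
apply: (@Kfree_map _ _ _ _ _ _ _
  (fun t' => syz_var t'.2 :: t'.1) s' c ASL_Kfree).
- move=> [t1 i1] [t2 i2]; rewrite !mem_filter /=.
  move=> /andP[/eqP g1 _] /andP[/eqP g2 _].
  by case=> v12 ->; rewrite (syz_index_inj _ v12) // g1 g2.
- by rewrite filter_uniq.
- apply/allP => [[t' i]]; rewrite mem_filter => /andP[_ /(allP ds)] /=.
  rewrite /MSL_standard /standard /=; case: t' => //= a t' /andP[-> ].
  by rewrite inE negbK => ->.
- have := congr1 (fun v : 'rV[A]_k => v 0 x) sum0.
  rewrite summxE mxE => sumx; rewrite -[RHS]sumx big_filter big_mkcond.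
  rewrite big_seq [RHS]big_seq; apply: eq_bigr => t' ts'.
  rewrite !mxE eqxx /= [x == _]eq_sym; case: eqP => [ex|_] /=.
    rewrite mulr1 corr_supp ?syz_varP ?ex ?ltnn // subr0.
    by rewrite /monomial big_cons [e _ * _]mulrC.
  rewrite mulr0 sub0r.
  have [lt|nlt] := boolP (R t < R t')%N.
    by rewrite c_top // scale0r mul0r.
  by rewrite corr_supp ?syz_varP // oppr0 !mulr0.
- by rewrite mem_filter eqxx.
Qed.

(** For b not above a, straightening b a yields terms gamma_1 ... gamma_s with
    gamma_1 < a; subtracting from b times the syzygy of (x, a) the syzygies of
    the (x, gamma_1) leaves a relation that no longer involves eps_x. *)
Lemma syz_straight i b : b \in syz_ideal i ->
  in_span syz_fam (fun j => syz_rank j < syz_rank i)%N (e b *: syz_fam i).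
Proof.
rewrite inE => nab; set x := syz_gen i; set a := syz_var i.
have [s [c [hs ec]]] := straighten_product nab.
have aI : a \in I x := syz_varP i.
(* The monomials t are not empty, so head a t is the first factor of t. *)
pose w := \sum_(t <- s) ((c t)%:A * monomial e (behead t)) *: syz x (head a t).
have headI t : t \in s -> head a t \in I x.
  case: t => [|d t] // /hs /andP[_ lt].
  by apply: (sf_ideal hsf aI); apply: ltW.
rewrite -[_ *: _](subrK w); apply: in_spanD; last first.
  apply: in_span_sum => -[|d t] ts; first by have := hs _ ts; rewrite andbF.
  have lt : (d < a)%O by case/andP: (hs _ ts).
  apply: in_spanZ; have [j gj vj] := syz_index (headI _ ts).
  rewrite -{1}gj -vj; apply: in_span_gen.
  rewrite /syz_rank gj vj ltn_add2l; apply: proper_card.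
  apply/fintype.properP; split.
    by apply/fintype.subsetP => y; rewrite !inE => /lt_trans ->.
  by exists d; rewrite !inE ?ltxx.
apply: (@in_span_sub _ _ _ _ _ (fun j => r (syz_gen j) < r x)%N).
  move=> j; rewrite !unfold_in => lt; rewrite /syz_rank.
  apply: (@leq_trans ((r (syz_gen j)).+1 * #|P|.+1)); last first.
    by apply: leq_trans (leq_addr _ _); rewrite leq_mul2r lt orbT.
  by rewrite mulSn addnC ltn_add2r ltnS max_card.
apply: relation_in_span; last first.
  rewrite combB combZ comb_syz ?scaler0 // /w comb_sum big_seq.
  rewrite big1 ?subrr // => t ts.
  by rewrite combZ comb_syz ?scaler0 // headI.
move=> y nlt; rewrite /w !mxE summxE corr_supp // subr0 mulrA ec mulr_suml.
apply/eqP; rewrite subr_eq0; apply/eqP; rewrite big_seq [RHS]big_seq.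
apply: eq_bigr => t ts; rewrite !mxE corr_supp ?headI // subr0 mulrA.
congr (_ * _); rewrite -mulrA; congr (_ * _).
case: t ts => [/hs|d t _]; first by rewrite andbF.
by rewrite /monomial big_cons mulrC.
Qed.

Lemma syz_straightening : straightening_family syz_fam syz_ideal syz_rank.
Proof.
split; [|exact: syz_free|exact: syz_straight].
by move=> i a b; rewrite !inE => na ba; apply: contra na => /le_trans -> .
Qed.
End Syzygies.
End Straightening.

(** * The resolution of a module with straightening laws *)

Section Resolution.
Variables (K : fieldType) (A : comAlgType K) (AG : nat -> set A).
Variable piA : int -> A -> A.
Hypothesis hA : algebra_components AG piA.
Variables (dP : Order.disp_t) (P : finPOrderType dP) (e : P -> A).
Variable degP : P -> nat.
Hypothesis hASL : is_ASL AG e degP.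

(** A straightening family of homogeneous elements in a graded module.  The
    module varies along the resolution: it is M first, and then the free
    module of the preceding stage. *)
Record stage := Stage {
  st_mod : lmodType A;
  st_gr : int -> set st_mod;
  st_pi : int -> st_mod -> st_mod;
  st_comp : has_components AG st_gr st_pi;
  st_size : nat;
  st_gen : 'I_st_size -> st_mod;
  st_ideal : 'I_st_size -> {set P};
  st_rank : 'I_st_size -> nat;
  st_deg : 'I_st_size -> int;
  st_straight : straightening_family e st_gen st_ideal st_rank;
  st_homog : forall i, st_gr (st_deg i) (st_gen i)
}.

Lemma correction_exists (X : stage) :
  exists corr : 'I_(st_size X) -> P -> 'rV[A]_(st_size X),
  [/\ forall x a y, a \in st_ideal x -> ~~ (st_rank y < st_rank x)%N ->
        corr x a 0 y = 0,
      forall x a, a \in st_ideal x ->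
        e a *: st_gen x = comb (@st_gen X) (corr x a)
    & forall x a, a \in st_ideal x ->
        row_homog AG (@st_deg X) ((degP a)%:Z + st_deg x) (corr x a)].
Proof.
have [hpiA _] := hA.
have /choice [f hf] : forall p : 'I_(st_size X) * P,
    exists v : 'rV[A]_(st_size X), p.2 \in st_ideal p.1 ->
    [/\ forall y, ~~ (st_rank y < st_rank p.1)%N -> v 0 y = 0,
        e p.2 *: st_gen p.1 = comb (@st_gen X) v
      & row_homog AG (@st_deg X) ((degP p.2)%:Z + st_deg p.1) v].
  case=> x a /=; have [aI|] := boolP (a \in st_ideal x); last by exists 0.
  have [v hv ev] := sf_straight (st_straight X) aI.
  set j := (degP a)%:Z + st_deg x.
  exists (row_comp piA (@st_deg X) j v) => _; split.
  - by move=> y hy; rewrite mxE hv // (comp0 hpiA).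
  - rewrite (comb_row_comp hA _ _ (st_comp X) (@st_homog X)) -ev.
    apply/esym/(proj1 (homogP (st_comp X) _ _)).
    exact: (comp_scale (st_comp X) (ASL0_homog hASL a) (st_homog x)).
  - exact: (comp_homog (row_has_components hA _)).
exists (fun x a => f (x, a)); split.
- by move=> x a y aI; case: (hf (x, a) aI) => H _ _; apply: H.
- by move=> x a aI; case: (hf (x, a) aI).
- by move=> x a aI; case: (hf (x, a) aI).
Qed.

Definition correction X := sval (cid (correction_exists X)).

Lemma correction_supp X x a y : a \in st_ideal x ->
  ~~ (st_rank y < st_rank x)%N -> @correction X x a 0 y = 0.
Proof. by rewrite /correction; case: cid => f /= [H _ _]; apply: H. Qed.

Lemma correctionE X x a : a \in st_ideal x ->
  e a *: st_gen x = comb (@st_gen X) (@correction X x a).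
Proof. by rewrite /correction; case: cid => f /= [_ H _]; apply: H. Qed.

Lemma correction_homog X x a : a \in st_ideal x ->
  row_homog AG (@st_deg X) ((degP a)%:Z + st_deg x) (@correction X x a).
Proof. by rewrite /correction; case: cid => f /= [_ _ H]; apply: H. Qed.

Definition syz_deg X (i : 'I_#|{: syz_type (@st_ideal X)}|) : int :=
  (degP (syz_var i))%:Z + st_deg (syz_gen i).

Lemma delta_homog k (deg : 'I_k -> int) x :
  row_homog AG deg (deg x) (delta_mx 0 x).
Proof.
move=> l; rewrite mxE eqxx /=; case: eqP => [->|_].
  rewrite subrr /=; have [_ -> _] := ASL0_graded hASL.
  by exists 1; rewrite ?scale1r.
by have [hpiA _] := hA; apply/(homogP hpiA); rewrite (comp0 hpiA).
Qed.

Lemma syz_homog X i :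
  row_homog AG (@st_deg X) (syz_deg i) (syz_fam e (@correction X) i).
Proof.
apply: (homogB (row_has_components hA _)).
  apply: (comp_scale (row_has_components hA _) (ASL0_homog hASL _)).
  exact: delta_homog.
by apply: correction_homog; apply: syz_varP.
Qed.

Definition next_stage (X : stage) : stage :=
  Stage (row_has_components hA (@st_deg X))
    (syz_straightening hASL (st_straight X)
      (@correction_supp X) (@correctionE X))
    (@syz_homog X).

Lemma next_stage_exact X (v : 'rV[A]_(st_size X)) :
  comb (@st_gen X) v = 0 <-> exists w, v = comb (@st_gen (next_stage X)) w.
Proof.
exact: (syz_exact hASL (st_straight X) (@correction_supp X) (@correctionE X)).
Qed.

Section Iteration.
Variables (M : lmodType A) (MG : int -> set M) (pi : int -> M -> M).
Hypothesis hpi : has_components AG MG pi.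
Variables (k : nat) (g : 'I_k -> M) (I : 'I_k -> {set P}) (r : 'I_k -> nat).
Variable deg : 'I_k -> int.
Hypothesis hsf : straightening_family e g I r.
Hypothesis hg : forall i, MG (deg i) (g i).
Hypothesis g_surj : forall x, exists v, x = comb g v.

Definition stages n : stage := iter n next_stage (Stage hpi hsf hg).

Definition stage_mx n : 'M[A]_(st_size (stages n.+1), st_size (stages n)) :=
  \matrix_i (st_gen (s := stages n.+1) i : 'rV[A]_(st_size (stages n))).

Lemma mul_stage_mx n v : v *m stage_mx n = comb (@st_gen (stages n.+1)) v.
Proof. by rewrite combE_mul; apply: eq_bigr => i _; rewrite rowK. Qed.

Lemma stage_mx_homog n i l :
  zpart AG (@st_deg (stages n.+1) i - @st_deg (stages n) l) (stage_mx n i l).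
Proof. by rewrite mxE; exact: (st_homog (s := stages n.+1) i). Qed.

Lemma stage_mx_exact n (v : 'rV[A]_(st_size (stages n))) :
  comb (@st_gen (stages n)) v = 0 <-> exists w, v = w *m stage_mx n.
Proof.
by split=> [/next_stage_exact|] [w ->]; [|apply/next_stage_exact];
  exists w; rewrite mul_stage_mx.
Qed.

Lemma stage_mx_exactS n (v : 'rV[A]_(st_size (stages n.+1))) :
  v *m stage_mx n = 0 <-> exists w, v = w *m stage_mx n.+1.
Proof. by rewrite mul_stage_mx; exact (@stage_mx_exact n.+1 v). Qed.

Definition syzygy_resolution : gr_free_resolution AG MG :=
  GrFreeResolution (augm := g) stage_mx_homog hg g_surj
    (stage_mx_exact (n := 0)) stage_mx_exactS.

Lemma syzygy_resolution_deg (m : int) n i : (forall x, deg x <= m) ->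
  @gdeg _ _ _ _ _ syzygy_resolution n i <= n%:Z * (max_degP degP)%:Z + m.
Proof.
move=> hm; elim: n i => [|n IH] i; first by rewrite mul0r add0r; apply: hm.
rewrite intS mulrDl mul1r -addrA; apply: lerD; last exact: IH.
by rewrite lez_nat; apply: leq_bigmax.
Qed.

End Iteration.

(** A smaller element of Q has strictly fewer elements below it, so the number of
    these can serve as the rank. *)
Lemma MSL_straightening (M : lmodType A) (dQ : Order.disp_t)
    (Q : finPOrderType dQ) (q : Q -> M) : is_MSL e q ->
  exists I, straightening_family e (fun i : 'I_#|Q| => q (enum_val i)) I
    (fun i => #|[pred y | (y < enum_val i)%O]|).
Proof.
case=> _ [I [hI [_ hfree] hstr]].
exists (fun i => I (enum_val i)); split=> [x|s c us ds sum0 t ts|x a aI].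
- exact: hI.
- apply: (@Kfree_map _ _ _ _ _ _ _
    (fun t => (t.1, enum_val t.2)) s c hfree) => //.
  move=> [t1 i1] [t2 i2] _ _ [-> /enum_val_inj ->] //.
- have [c ->] := hstr _ _ aI; rewrite big_mkcond.
  apply: in_span_sum => y _; case: ifP => [lt|_]; last exact: in_span0.
  apply: in_spanZ; rewrite -[y in q y]enum_rankK.
  apply: (in_span_gen (fun i => q (enum_val i))); rewrite enum_rankK.
  apply: proper_card; apply/fintype.properP; split.
    by apply/fintype.subsetP => z; rewrite !inE => /lt_trans ->.
  by exists y; rewrite !inE ?ltxx.
Qed.

Lemma MSL_generates (M : lmodType A) (dQ : Order.disp_t)
    (Q : finPOrderType dQ) (q : Q -> M) : is_MSL e q ->
  forall x, exists v, x = comb (fun i : 'I_#|Q| => q (enum_val i)) v.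
Proof.
case=> _ [I [_ [hspan _] _]] x; have [s [c [_ _ ->]]] := hspan x.
suff [v _ ->] : in_span (fun i : 'I_#|Q| => q (enum_val i)) predT
    (\sum_(t <- s) (c t)%:A *: (monomial e t.1 *: q t.2)) by exists v.
apply: in_span_sum => t _; rewrite scalerA -[t.2]enum_rankK.
exact/in_spanZ/(in_span_gen (fun i => q (enum_val i))).
Qed.

End Resolution.

(** * The bound on the rate *)

(** The generators of degree at most m of M are the basis in homological degree
    0, and each step to the next syzygies adds the degree of an element of P. *)
Lemma Tor_degree_le (K : fieldType) (A : comAlgType K) (AG : nat -> set A)
    (dP : Order.disp_t) (P : finPOrderType dP) (e : P -> A) (degP : P -> nat)
    (M : lmodType A) (MG : int -> set M)
    (dQ : Order.disp_t) (Q : finPOrderType dQ) (q : Q -> M) (degQ : Q -> int)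
    (m : int) i j :
  is_ASL AG e degP -> is_graded_module AG MG -> is_MSL e q ->
  (forall x, MG (degQ x) (q x)) -> (forall x, degQ x <= m) ->
  Tor_neq0 AG MG i.+1 j -> j <= i.+1%:Z * (max_degP degP)%:Z + m.
Proof.
move=> hASL hM hMSL hq hm [F hF].
have [piA hA] := algebra_components_exist (ASL0_graded hASL).
have [pi hpi] := module_components_exist hM.
have [I hsf] := MSL_straightening hMSL.
pose G := syzygy_resolution hA hASL hpi hsf (fun i => hq (enum_val i))
  (MSL_generates hMSL).
apply: (homology_degree_le hA hM (G := G)) hF => k.
by apply: syzygy_resolution_deg => x; apply: hm.
Qed.

Theorem corollary2p4 (R : realType) (K : fieldType) (A : comAlgType K)
    (AG : nat -> set A)
    (dP : Order.disp_t) (P : finPOrderType dP) (e : P -> A) (degP : P -> nat)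
    (hA : is_ASL AG e degP)
    (M : lmodType A) (MG : int -> set M) (hM : is_graded_module AG MG)
    (dQ : Order.disp_t) (Q : finPOrderType dQ) (q : Q -> M) (degQ : Q -> int)
    (hMSL : is_MSL e q) (hq : forall x : Q, MG (degQ x) (q x)) :
  (rate AG MG R <= ((((max_degP degP)%:Z + max_degQ degQ)%:~R : R)%:E))%E.
Proof.
have hm x : degQ x <= max_degQ degQ by apply: le_bigmax.
have m0 : 0 <= max_degQ degQ by apply: bigmax_ge_id.
apply: ge_ereal_sup => _ [[//|i] _ <-].
rewrite lee_pdivrMr ?ltr0n //.
apply: ge_ereal_sup => _ [j hj <-].
rewrite -EFinM lee_fin -[i.+1%:R]/(i.+1%:~R) -intrM ler_int.
apply: le_trans (Tor_degree_le hA hM hMSL hq hm hj) _.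
rewrite [leRHS]mulrC mulrDr lerD2l.
by rewrite ler_peMl.
Qed.
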